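(* Every partial groupoid $L$ admits a characteristic action. Moreover, if $\rho\colon E \to L$ is a characteristic action of a partial groupoid $L$ and $L$ embeds in $BG$ for some group $G$ (so that $L$ is regarded as a symmetric subset of $BG$), then there is a partial action of $G$ on the set $E_0$ such that $\rho$ is isomorphic to the canonical map $N(E_0/\!\!/G) \to L_{E_0}(G) = L$.
   Context: Let $\Upsilon$ be the category with objects $[n]=\{0,1,\dots,n\}$, $n\ge 0$, and all functions as morphisms. A symmetric set is a functor $X\colon\Upsilon^{\mathrm{op}}\to\mathsf{Set}$; write $X_n=X([n])$. Restricting to order-preserving maps gives its underlying simplicial set, with faces $d_i$ and degeneracies $s_i$. Let $\epsilon_{ij}\colon[1]\to[n]$ send $0\mapsto i$, $1\mapsto j$. A symmetric set $X$ is spiny if for all $n\ge1$ the map $X_n\to\prod_{i=1}^n X_1$, $x\mapsto(\epsilon_{01}^*x,\epsilon_{12}^*x,\dots,\epsilon_{n-1,n}^*x)$, is injective; an $n$-simplex is then written $[f_1|\cdots|f_n]$ if its image is $(f_1,\dots,f_n)$. A partial groupoid is a spiny symmetric set. The nerve $NC$ of a groupoid $C$ is a symmetric set whose $n$-simplices are the functors to $C$ from the groupoid with object set $[n]$ and exactly one morphism between any two objects; $BG$ denotes the nerve of a group $G$ viewed as a one-object groupoid. A partial groupoid ''is a groupoid'' if it is isomorphic to the nerve of a groupoid. For a symmetric set $X$ and $x\in X_0$, the star of $x$ is the set of all simplices (of all dimensions $n\ge0$) whose initial ($0$th) vertex is $x$. A map $\rho\colon E\to L$ of partial groupoids is star injective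 if for every $x\in E_0$ the induced map from the star of $x$ to the star of $\rho(x)$ is injective. A characteristic action of $L$ (on the set $E_0$), also called a characteristic map, is a star injective map $\rho\colon E\to L$ of partial groupoids such that $E$ is a groupoid and $\rho$ is surjective (in every degree). A partial action of a group $G$ on a set $S$ is a partially defined function $\cdot\colon G\times S\to S$ such that for all $g,h\in G$, $x\in S$: (1) $1\cdot x$ is defined and equals $x$; (2) if $h\cdot(g\cdot x)$ is defined then $(hg)\cdot x$ is defined and they are equal; (3) if $g\cdot x$ is defined then $g^{-1}\cdot(g\cdot x)$ is defined. Its transporter groupoid $S/\!\!/G$ has object set $S$ and one morphism $x\xrightarrow{g}g\cdot x$ for each pair $(g,x)$ with $g\cdot x$ defined; there is a functor $S/\!\!/G\to G$ recording $g$. $L_S(G)\subseteq BG$ denotes the image of $N(S/\!\!/G)\to BG$. *)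

(* Defs.v *)
From HB Require Import structures.
From mathcomp Require Import all_boot.
From mathcomp Require Import boolp.

Set Implicit Arguments.
Unset Strict Implicit.
Unset Printing Implicit Defensive.

(* The object [n] = {0, ..., n} is 'I_n.+1. *)
Record symset : Type := SymSet {
  simplex :> nat -> Type;
  act : forall m n : nat, ('I_m.+1 -> 'I_n.+1) -> simplex n -> simplex m;
  act_id : forall (n : nat) (x : simplex n), act id x = x;
  act_comp : forall (l m n : nat) (f : 'I_m.+1 -> 'I_n.+1)
      (g : 'I_l.+1 -> 'I_m.+1) (x : simplex n),
    act (f \o g) x = act g (act f x)
}.

Record symmap (X Y : symset) : Type := SymMap {
  symfun :> forall n : nat, X n -> Y n;
  symmap_act : forall (m n : nat) (f : 'I_m.+1 -> 'I_n.+1) (x : X n),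
    symfun (act f x) = act f (symfun x)
}.

Definition sym_iso (X Y : symset) (f : symmap X Y) : Prop :=
  exists g : symmap Y X, forall n : nat,
    cancel (f n) (g n) /\ cancel (g n) (f n).

Definition sym_injective (X Y : symset) (f : symmap X Y) : Prop :=
  forall n : nat, injective (f n).

Definition sym_surjective (X Y : symset) (f : symmap X Y) : Prop :=
  forall (n : nat) (y : Y n), exists x : X n, f n x = y.

Record symsubset (X : symset) : Type := SymSubset {
  insub_sym : forall n : nat, X n -> Prop;
  insub_act : forall (m n : nat) (f : 'I_m.+1 -> 'I_n.+1) (x : X n),
    insub_sym x -> insub_sym (act f x)
}.

Section Subset.
Variables (X : symset) (A : symsubset X).

Definition subset_simplex (n : nat) : Type := {x : X n | insub_sym A x}.

Lemma subset_simplex_eq (n : nat) (x y : subset_simplex n) :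
  sval x = sval y -> x = y.
Proof.
case: x y => [x Ax] [y Ay] /= exy; case: y / exy Ay => Ay.
by rewrite (Prop_irrelevance Ax Ay).
Qed.

Definition subset_act (m n : nat) (f : 'I_m.+1 -> 'I_n.+1)
    (x : subset_simplex n) : subset_simplex m :=
  exist _ (act f (sval x)) (insub_act f (svalP x)).

Lemma subset_act_id (n : nat) (x : subset_simplex n) : subset_act id x = x.
Proof. by apply: subset_simplex_eq; rewrite /= act_id. Qed.

Lemma subset_act_comp (l m n : nat) (f : 'I_m.+1 -> 'I_n.+1)
    (g : 'I_l.+1 -> 'I_m.+1) (x : subset_simplex n) :
  subset_act (f \o g) x = subset_act g (subset_act f x).
Proof. by apply: subset_simplex_eq; rewrite /= act_comp. Qed.

Definition subset_symset : symset := SymSet subset_act_id subset_act_comp.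

Definition subset_incl : symmap subset_symset X :=
  @SymMap subset_symset X (fun n x => sval x) (fun _ _ _ _ => erefl).

End Subset.

Coercion subset_symset : symsubset >-> symset.

Section Image.
Variables (X Y : symset) (f : symmap X Y).

Lemma image_act (m n : nat) (g : 'I_m.+1 -> 'I_n.+1) (y : Y n) :
  (exists x : X n, f n x = y) -> exists x : X m, f m x = act g y.
Proof. by case=> x <-; exists (act g x); rewrite symmap_act. Qed.

Definition sym_image : symsubset Y := SymSubset image_act.

Definition to_image_fun (n : nat) (x : X n) : subset_simplex sym_image n :=
  exist _ (f n x) (ex_intro _ x erefl).

Lemma to_image_act (m n : nat) (g : 'I_m.+1 -> 'I_n.+1) (x : X n) :
  to_image_fun (act g x) = subset_act g (to_image_fun x).
Proof. by apply: subset_simplex_eq; rewrite /= symmap_act. Qed.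

Definition to_image : symmap X sym_image :=
  @SymMap X sym_image to_image_fun to_image_act.

End Image.

Definition eps (n : nat) (i j : 'I_n.+1) : 'I_2 -> 'I_n.+1 :=
  fun k => if k == ord0 then i else j.

(* The i-th component (0 <= i < n) is the edge from vertex i to vertex i+1. *)
Definition spine (X : symset) (n : nat) (x : X n) : 'I_n -> X 1 :=
  fun i => act (eps (widen_ord (leqnSn n) i) (lift ord0 i)) x.

Definition spiny (X : symset) : Prop :=
  forall n : nat, 1 <= n -> injective (@spine X n).

Record partial_groupoid : Type := PartialGroupoid {
  pg_symset :> symset;
  pg_spiny : spiny pg_symset
}.

(* [gcomp f g] is in diagrammatic order: first f, then g. *)
Record groupoid : Type := Groupoid {
  ob :> Type;
  hom : ob -> ob -> Type;
  gid : forall x : ob, hom x x;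
  gcomp : forall x y z : ob, hom x y -> hom y z -> hom x z;
  ginv : forall x y : ob, hom x y -> hom y x;
  gcomp1f : forall (x y : ob) (f : hom x y), gcomp (gid x) f = f;
  gcompf1 : forall (x y : ob) (f : hom x y), gcomp f (gid y) = f;
  gcompA : forall (x y z t : ob) (f : hom x y) (g : hom y z) (h : hom z t),
    gcomp f (gcomp g h) = gcomp (gcomp f g) h;
  gcompfV : forall (x y : ob) (f : hom x y), gcomp f (ginv f) = gid x;
  gcompVf : forall (x y : ob) (f : hom x y), gcomp (ginv f) f = gid y
}.

Record functor (C D : groupoid) : Type := Functor {
  fob :> C -> D;
  fmor : forall x y : C, hom x y -> hom (fob x) (fob y);
  fmor_id : forall x : C, fmor (gid x) = gid (fob x);
  fmor_comp : forall (x y z : C) (f : hom x y) (g : hom y z),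
    fmor (gcomp f g) = gcomp (fmor f) (fmor g)
}.

Lemma functor_eq (C D : groupoid) (o : C -> D)
    (m : forall x y : C, hom x y -> hom (o x) (o y)) i1 i2 c1 c2 :
  @Functor C D o m i1 c1 = @Functor C D o m i2 c2.
Proof. by rewrite (Prop_irrelevance i1 i2) (Prop_irrelevance c1 c2). Qed.

Section FunctorComp.
Variables (B C D : groupoid) (F : functor B C) (G : functor C D).

Lemma fcomp_id (x : B) : fmor G (fmor F (gid x)) = gid (G (F x)).
Proof. by rewrite !fmor_id. Qed.

Lemma fcomp_comp (x y z : B) (f : hom x y) (g : hom y z) :
  fmor G (fmor F (gcomp f g)) =
  gcomp (fmor G (fmor F f)) (fmor G (fmor F g)).
Proof. by rewrite !fmor_comp. Qed.

Definition fcomp : functor B D :=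
  @Functor B D (fun x => G (F x)) (fun x y f => fmor G (fmor F f))
    fcomp_id fcomp_comp.

End FunctorComp.

Lemma unit_eq (x y : unit) : x = y.
Proof. by case: x; case: y. Qed.

Definition indiscrete (T : Type) : groupoid :=
  @Groupoid T (fun _ _ => unit) (fun _ => tt) (fun _ _ _ _ _ => tt)
    (fun _ _ _ => tt) (fun _ _ _ => unit_eq _ _) (fun _ _ _ => unit_eq _ _)
    (fun _ _ _ _ _ _ _ => erefl) (fun _ _ _ => erefl) (fun _ _ _ => erefl).

Definition indiscrete_map (S T : Type) (f : S -> T) :
    functor (indiscrete S) (indiscrete T) :=
  @Functor (indiscrete S) (indiscrete T) f (fun _ _ u => u)
    (fun _ => erefl) (fun _ _ _ _ _ => erefl).

Section Nerve.
Variable C : groupoid.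

Definition nerve_simplex (n : nat) : Type := functor (indiscrete 'I_n.+1) C.

Definition nerve_act (m n : nat) (f : 'I_m.+1 -> 'I_n.+1)
    (x : nerve_simplex n) : nerve_simplex m := fcomp (indiscrete_map f) x.

Lemma nerve_act_id (n : nat) (x : nerve_simplex n) : nerve_act id x = x.
Proof. by case: x => o m i c; apply: functor_eq. Qed.

Lemma nerve_act_comp (l m n : nat) (f : 'I_m.+1 -> 'I_n.+1)
    (g : 'I_l.+1 -> 'I_m.+1) (x : nerve_simplex n) :
  nerve_act (f \o g) x = nerve_act g (nerve_act f x).
Proof. exact: functor_eq. Qed.

Definition nerve : symset := SymSet nerve_act_id nerve_act_comp.

End Nerve.

Section NerveMap.
Variables (C D : groupoid) (F : functor C D).

Lemma nerve_map_act (m n : nat) (f : 'I_m.+1 -> 'I_n.+1) (x : nerve C n) :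
  fcomp (act f x) F = act f (fcomp x F : nerve D n).
Proof. exact: functor_eq. Qed.

Definition nerve_map : symmap (nerve C) (nerve D) :=
  @SymMap (nerve C) (nerve D) (fun n (x : nerve C n) => fcomp x F)
    nerve_map_act.

End NerveMap.

Definition is_groupoid (X : symset) : Prop :=
  exists (C : groupoid) (f : symmap (nerve C) X), sym_iso f.

Definition initial_vertex (X : symset) (n : nat) (x : X n) : X 0 :=
  act (fun _ : 'I_1 => ord0 : 'I_n.+1) x.

Definition star (X : symset) (x : X 0) : Type :=
  {n : nat & {s : X n | initial_vertex s = x}}.

Section StarMap.
Variables (X Y : symset) (f : symmap X Y) (x : X 0).

Lemma star_map_subproof (n : nat) (s : X n) :
  initial_vertex s = x -> initial_vertex (f n s) = f 0 x.
Proof. by move=> <-; rewrite /initial_vertex symmap_act. Qed.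

Definition star_map (t : star x) : star (f 0 x) :=
  let: existT n (exist s sx) := t in
  existT _ n (exist _ (f n s) (star_map_subproof sx)).

End StarMap.

Definition star_injective (X Y : symset) (f : symmap X Y) : Prop :=
  forall x : X 0, injective (@star_map X Y f x).

Definition characteristic (E L : partial_groupoid) (rho : symmap E L) : Prop :=
  [/\ star_injective rho, is_groupoid E & sym_surjective rho].

(* Using groupType loses no group: the choice operator it requires on the
   underlying type exists classically. *)
Section GroupGroupoid.
Variable G : groupType.
Local Open Scope group_scope.

(* First g, then h is h * g, so that recording g is covariant on the
   transporter groupoid of a left partial action. *)
Definition group_groupoid : groupoid :=
  @Groupoid unit (fun _ _ => G) (fun _ => 1) (fun _ _ _ g h => h * g)
    (fun _ _ g => g^-1) (fun _ _ g => mulg1 g) (fun _ _ g => mul1g g)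
    (fun _ _ _ _ f g h => esym (mulgA h g f))
    (fun _ _ g => mulVg g) (fun _ _ g => mulgV g).

Definition BG : symset := nerve group_groupoid.

End GroupGroupoid.

(* The product g . x is defined when [pact g x] is [Some _]. *)
Record partial_action (G : groupType) (S : Type) : Type := PartialAction {
  pact :> G -> S -> option S;
  pact1 : forall x : S, pact 1%g x = Some x;
  pactM : forall (g h : G) (x y z : S),
    pact g x = Some y -> pact h y = Some z -> pact (h * g)%g x = Some z;
  pactV : forall (g : G) (x y : S),
    pact g x = Some y -> exists z : S, pact g^-1%g y = Some z
}.

Section Transporter.
Variables (G : groupType) (S : Type) (a : partial_action G S).
Local Open Scope group_scope.

Definition tr_hom (x y : S) : Type := {g : G | a g x = Some y}.

Lemma tr_hom_eq (x y : S) (f g : tr_hom x y) : sval f = sval g -> f = g.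
Proof.
case: f g => [f fP] [g gP] /= efg; case: g / efg gP => gP.
by rewrite (Prop_irrelevance fP gP).
Qed.

Lemma pactVK (g : G) (x y : S) : a g x = Some y -> a g^-1 y = Some x.
Proof.
move=> gx; have [z gy] := pactV gx.
by rewrite gy -(pactM gx gy) mulVg pact1.
Qed.

Definition tr_id (x : S) : tr_hom x x := exist _ 1 (pact1 a x).

Definition tr_comp (x y z : S) (f : tr_hom x y) (g : tr_hom y z) : tr_hom x z :=
  exist _ (sval g * sval f) (pactM (svalP f) (svalP g)).

Definition tr_inv (x y : S) (f : tr_hom x y) : tr_hom y x :=
  exist _ (sval f)^-1 (pactVK (svalP f)).

Lemma tr_comp1f (x y : S) (f : tr_hom x y) : tr_comp (tr_id x) f = f.
Proof. by apply: tr_hom_eq; rewrite /= mulg1. Qed.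

Lemma tr_compf1 (x y : S) (f : tr_hom x y) : tr_comp f (tr_id y) = f.
Proof. by apply: tr_hom_eq; rewrite /= mul1g. Qed.

Lemma tr_compA (x y z t : S) (f : tr_hom x y) (g : tr_hom y z) (h : tr_hom z t) :
  tr_comp f (tr_comp g h) = tr_comp (tr_comp f g) h.
Proof. by apply: tr_hom_eq; rewrite /= mulgA. Qed.

Lemma tr_compfV (x y : S) (f : tr_hom x y) : tr_comp f (tr_inv f) = tr_id x.
Proof. by apply: tr_hom_eq; rewrite /= mulVg. Qed.

Lemma tr_compVf (x y : S) (f : tr_hom x y) : tr_comp (tr_inv f) f = tr_id y.
Proof. by apply: tr_hom_eq; rewrite /= mulgV. Qed.

Definition transporter : groupoid :=
  Groupoid tr_comp1f tr_compf1 tr_compA tr_compfV tr_compVf.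

Definition transporter_functor : functor transporter (group_groupoid G) :=
  @Functor transporter (group_groupoid G) (fun _ => tt) (fun x y f => sval f)
    (fun _ => erefl) (fun _ _ _ _ _ => erefl).

(* The symmetric subset L_S(G) of BG. *)
Definition transporter_image : symsubset (BG G) :=
  sym_image (nerve_map transporter_functor).

Definition transporter_map : symmap (nerve transporter) transporter_image :=
  to_image (nerve_map transporter_functor).

End Transporter.

(* Main.v *)
(** Existence: let E be the disjoint union, over all simplices s of L, of the
    indiscrete groupoids on the vertices of s, where vertices j and k of s are
    identified when the edges 0 -> j and 0 -> k of s coincide. Sending a
    sequence f of vertices of s to the pullback of s along f is star injective
    because spininess lets edges with a common vertex be composed.

    Given a characteristic action E -> L and an embedding of L in BG, put
    g . x = y when some edge of E from x to y has label g in BG. Star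
    injectivity makes such an edge unique, so y is determined, and
    makes a simplex of E determined by its initial vertex and its labels; since
    E is a groupoid, every cone of edges extends to a simplex, so every simplex
    of the transporter groupoid comes from E. *)
From Stdlib Require Import Eqdep_dec.
Require Import Defs.
From mathcomp Require Import all_boot.
From mathcomp Require Import boolp.

Set Implicit Arguments.
Unset Strict Implicit.
Unset Printing Implicit Defensive.

(** * Vertices and edges of simplices; calculus of edges under spininess *)

Section Symmetric.
Variable X : symset.

Definition vertex (n : nat) (x : X n) (k : 'I_n.+1) : X 0 :=
  act (fun _ : 'I_1 => k) x.

Definition edge (n : nat) (x : X n) (a b : 'I_n.+1) : X 1 := act (eps a b) x.

Lemma eq_act (m n : nat) (f g : 'I_m.+1 -> 'I_n.+1) (x : X n) :
  f =1 g -> act f x = act g x.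
Proof. by move=> /funext ->. Qed.

Lemma edge_act (m n : nat) (f : 'I_m.+1 -> 'I_n.+1) (x : X n) a b :
  edge (act f x) a b = edge x (f a) (f b).
Proof.
by rewrite /edge -act_comp; apply: eq_act => k; rewrite /= /eps; case: ifP.
Qed.

Lemma vertex_act (m n : nat) (f : 'I_m.+1 -> 'I_n.+1) (x : X n) a :
  vertex (act f x) a = vertex x (f a).
Proof. by rewrite /vertex -act_comp. Qed.

Lemma vertex_edge (n : nat) (x : X n) a b k :
  vertex (edge x a b) k = vertex x (eps a b k).
Proof. exact: vertex_act. Qed.

Lemma vertex0 (x : X 0) k : vertex x k = x.
Proof.
by rewrite /vertex -[RHS]act_id; apply: eq_act => j; rewrite !ord1.
Qed.

Lemma spine_edge (n : nat) (x : X n) (i : 'I_n) :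
  spine x i = edge x (widen_ord (leqnSn n) i) (lift ord0 i).
Proof. by []. Qed.

(** Vertex [k + 1] is the target of the [k]-th spine edge, and vertex 0 is the source of the first
    one. *)
Lemma spine_vertex (n : nat) (x y : X n) : 0 < n ->
  spine x = spine y -> vertex x = vertex y.
Proof.
case: n x y => [//|n] x y _ exy; apply/funext => k.
case: (unliftP ord0 k) => [i ->|->].
  have /(congr1 (fun e => vertex e ord_max)) := congr1 (fun s => s i) exy.
  by rewrite !spine_edge !vertex_edge.
have /(congr1 (fun e => vertex e ord0)) := congr1 (fun s => s ord0) exy.
rewrite !spine_edge !vertex_edge /eps /=.
by have -> : widen_ord (leqnSn n.+1) ord0 = ord0 by apply: val_inj.
Qed.

Lemma edge_sym (m n : nat) (x : X m) (y : X n) a b a' b' :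
  edge x a b = edge y a' b' -> edge x b a = edge y b' a'.
Proof.
move=> /(congr1 (fun e => edge e ord_max ord0)).
by rewrite ![edge (edge _ _ _) _ _]edge_act.
Qed.

Hypothesis X_spiny : spiny X.

(** This replaces composition of edges: the triangles on [a, b, c] and [a', b', c'] have the same
    spine, so by spininess they are equal, long edges included. *)
Lemma edge_trans (m n : nat) (x : X m) (y : X n) a b c a' b' c' :
  edge x a b = edge y a' b' -> edge x b c = edge y b' c' ->
  edge x a c = edge y a' c'.
Proof.
move=> eab ebc.
pose t (T : Type) (u v w : T) (k : 'I_3) : T :=
  if val k == 0 then u else if val k == 1 then v else w.
have exy : act (t _ a b c) x = act (t _ a' b' c') y.
  apply: X_spiny => //; apply/funext => i; rewrite !spine_edge !edge_act.
  by case: i => [[|[|?]] ?].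
by have := congr1 (fun e => edge e ord0 ord_max) exy; rewrite !edge_act.
Qed.

(** Each spine edge of a pullback is a composite through vertex 0 of [x], hence fixed by the edges
    leaving that vertex. *)
Lemma act_eq_of_edge0 (m n : nat) (f g : 'I_m.+1 -> 'I_n.+1) (x : X n) :
  (forall k, edge x ord0 (f k) = edge x ord0 (g k)) -> act f x = act g x.
Proof.
move=> efg; case: m f g efg => [|m] f g efg.
  (* Spininess says nothing in degree 0; the single vertex is read off as the target of the given
     edge. *)
  have /(congr1 (fun e => vertex e ord_max)) := efg ord0.
  rewrite !vertex_edge /vertex /eps /= => e.
  by rewrite -[LHS](vertex0 _ ord0) -[RHS](vertex0 _ ord0) !vertex_act.
apply: X_spiny => //; apply/funext => i; rewrite !spine_edge !edge_act.
by apply: edge_trans (efg _); apply: edge_sym.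
Qed.

(** The edge [0 -> f k] is composed of [0 -> f 0] and [f 0 -> f k], and the latter is an edge of the
    pullback. *)
Lemma edge0_eq_of_act (m n : nat) (f g : 'I_m.+1 -> 'I_n.+1) (x : X n) :
  edge x ord0 (f ord0) = edge x ord0 (g ord0) -> act f x = act g x ->
  forall k, edge x ord0 (f k) = edge x ord0 (g k).
Proof.
move=> e0 efg k; apply: edge_trans e0 _.
by have := congr1 (fun e => edge e ord0 k) efg; rewrite !edge_act.
Qed.

End Symmetric.

(** * Criteria for star injectivity, isomorphisms and equality of functors *)

Lemma existT_nat_inj (T : nat -> Type) (n : nat) (u v : T n) :
  existT T n u = existT T n v -> u = v.
Proof. exact: (inj_pair2_eq_dec nat (@eq_comparable nat)). Qed.

Lemma star_injectiveP (X Y : symset) (f : symmap X Y) :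
  star_injective f <->
  forall n (s t : X n), vertex s ord0 = vertex t ord0 -> f n s = f n t -> s = t.
Proof.
split=> [finj n s t est efst|finj x [m [s sx]] [n [t tx]] /= efst].
  have := finj _ (existT _ n (exist _ s est)) (existT _ n (exist _ t erefl)).
  move=> /= st; have {}/st : existT
      (fun n => {u : Y n | initial_vertex u = f 0 (vertex t ord0)})
      n (exist _ (f n s) (star_map_subproof f est)) =
    existT _ n (exist _ (f n t) (star_map_subproof f erefl)).
    by congr existT; apply: eq_exist.
  by move=> eqst; have [] := existT_nat_inj eqst.
(* The star map keeps the dimension, so simplices with equal images have equal dimension. *)
have emn := congr1 (@projT1 _ _) efst; rewrite /= in emn; subst n.
have [e] := existT_nat_inj efst.
congr existT; apply: eq_exist; apply: finj => //.
exact: etrans sx (esym tx).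
Qed.

Lemma symmap_vertex (X Y : symset) (f : symmap X Y) n (x : X n) k :
  f 0 (vertex x k) = vertex (f n x) k.
Proof. exact: symmap_act. Qed.

Lemma symmap_edge (X Y : symset) (f : symmap X Y) n (x : X n) a b :
  f 1 (edge x a b) = edge (f n x) a b.
Proof. exact: symmap_act. Qed.

Lemma sym_iso_bij (X Y : symset) (f : symmap X Y) :
  sym_injective f -> sym_surjective f -> sym_iso f.
Proof.
move=> finj fsurj.
pose g n (y : Y n) : X n := sval (cid (fsurj n y)).
have gK n (y : Y n) : f n (g n y) = y by rewrite /g; case: cid.
have g_act m n (h : 'I_m.+1 -> 'I_n.+1) (y : Y n) :
    g m (act h y) = act h (g n y).
  by apply: finj; rewrite symmap_act !gK.
exists (SymMap g_act) => n; split=> //= x.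
by apply: finj; rewrite gK.
Qed.

Lemma indiscrete_functor_eq (T : Type) (C : groupoid) (o : T -> C)
    (m m' : forall s t : T, unit -> hom (o s) (o t)) i i' c c' :
  (forall s t, m s t tt = m' s t tt) ->
  @Functor (indiscrete T) C o m i c = @Functor (indiscrete T) C o m' i' c'.
Proof.
move=> em; have {}em : m = m'; last by subst m'; apply: functor_eq.
do 2 (apply/functional_extensionality_dep => ?).
by apply/funext => -[]; apply: em.
Qed.

(** * Filling cones of edges in a groupoid *)

Section Cone.
Variables (C : groupoid) (T : Type) (c : C) (v : T -> {y : C & hom c y}).

Lemma cone_id t :
  gcomp (ginv (projT2 (v t))) (projT2 (v t)) = gid (projT1 (v t)).
Proof. exact: gcompVf. Qed.

Lemma cone_comp s t u :
  gcomp (ginv (projT2 (v s))) (projT2 (v u)) =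
  gcomp (gcomp (ginv (projT2 (v s))) (projT2 (v t)))
    (gcomp (ginv (projT2 (v t))) (projT2 (v u))).
Proof.
by rewrite -gcompA (gcompA (projT2 (v t))) gcompfV gcomp1f.
Qed.

Definition cone_functor : functor (indiscrete T) C :=
  @Functor (indiscrete T) C (fun t => projT1 (v t))
    (fun s t _ => gcomp (ginv (projT2 (v s))) (projT2 (v t)))
    cone_id (fun s t u _ _ => cone_comp s t u).

End Cone.

(** The legs are the arrows of [F] out of [t0]. The apex [c] is kept apart from [F t0] so that
    several functors can be written as cones over literally the same object. *)
Lemma cone_functorP (C : groupoid) (T : Type) (F : functor (indiscrete T) C)
    (t0 : T) (c : C) : F t0 = c ->
  exists2 v : T -> {y : C & hom c y},
    F = cone_functor v & v t0 = existT _ c (gid c).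
Proof.
move=> <-; exists (fun t => existT _ (F t) (@fmor _ _ F t0 t tt)); last first.
  by congr existT; apply: (fmor_id F t0).
case: F => o m i k; apply: indiscrete_functor_eq => s t /=.
by rewrite (k t0 s t tt tt) gcompA gcompVf gcomp1f.
Qed.

Lemma nerve_cone_ext (C : groupoid) (n : nat) (c : C)
    (e : 'I_n.+1 -> nerve C 1) : (forall a, fob (e a) ord0 = c) ->
  exists t : nerve C n.+1, forall a, edge t ord0 (lift ord0 a) = e a.
Proof.
move=> ec; have /choice [v vP] a : exists v : 'I_2 -> {y : C & hom c y},
    e a = cone_functor v /\ v ord0 = existT _ c (gid c).
  by have [v] := cone_functorP (ec a); exists v.
(* Vertex 0 carries the identity of the apex, and vertex [a + 1] the leg given by the edge [e a]. *)
pose w (k : 'I_n.+2) : {y : C & hom c y} :=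
  if unlift ord0 k is Some a then v a ord_max else existT _ c (gid c).
exists (cone_functor w : nerve C n.+1) => a; have [-> va0] := vP a.
have <- : w \o eps ord0 (lift ord0 a) = v a; last exact: functor_eq.
apply/funext => k; rewrite /= /eps /w.
have [->|k0] := eqVneq k ord0; first by rewrite unlift_none va0.
rewrite liftK; congr (v a _); apply: val_inj.
by case: k k0 => [[|[|?]] ?].
Qed.

Lemma groupoid_cone_ext (E : symset) (n : nat) (x : E 0)
    (e : 'I_n.+1 -> E 1) : is_groupoid E ->
  (forall a, vertex (e a) ord0 = x) ->
  exists t : E n.+1, forall a, edge t ord0 (lift ord0 a) = e a.
Proof.
move=> [C [f [g fg]]] ex.
have [|t tP] := @nerve_cone_ext C n (fob (g 0 x) ord0) (fun a => g 1 (e a)).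
  by move=> a; rewrite -(ex a) symmap_vertex.
exists (f _ t) => a.
by rewrite -symmap_edge tP; have [_ ->] := fg 1.
Qed.

(** * Construction of a characteristic action of an arbitrary [L] *)

Section Existence.
Variable L : partial_groupoid.

Definition cell : Type := {n : nat & L n}.

Definition star_edge (p : cell) (k : 'I_(projT1 p).+1) : L 1 :=
  edge (projT2 p) ord0 k.

(* The pair (s, e) stands for the vertices k of s such that e is the edge
   0 -> k of s. *)
Definition cell_vertex : Type :=
  {p : cell * L 1 | exists k : 'I_(projT1 p.1).+1, p.2 = star_edge k}.

Definition cell_of (x : cell_vertex) : cell := (sval x).1.

(** Taking proofs of equality of cells as morphisms gives the disjoint union of indiscrete
    groupoids, with all laws by proof irrelevance. *)
Definition cell_groupoid : groupoid :=
  @Groupoid cell_vertex (fun x y => cell_of x = cell_of y) (fun _ => erefl)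
    (fun _ _ _ => @etrans _ _ _ _) (fun _ _ => @esym _ _ _)
    (fun _ _ _ => Prop_irrelevance _ _) (fun _ _ _ => Prop_irrelevance _ _)
    (fun _ _ _ _ _ _ _ => Prop_irrelevance _ _)
    (fun _ _ _ => Prop_irrelevance _ _) (fun _ _ _ => Prop_irrelevance _ _).

Lemma cell_simplex_eq (n : nat) (s t : nerve cell_groupoid n) :
  (forall k, sval (fob s k) = sval (fob t k)) -> s = t.
Proof.
case: s t => [o m i c] [o' m' i' c'] /= e.
have eo : o = o'.
  apply/funext => k; move: (e k).
  by case: (o k) (o' k) => [? ?] [? ?] /=; apply: eq_exist.
subst o'; apply: indiscrete_functor_eq => *.
exact: (@Prop_irrelevance (_ = _ :> cell)).
Qed.

Lemma cell_nerve_spiny : spiny (nerve cell_groupoid).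
Proof.
move=> n n_gt0 s t /(spine_vertex n_gt0) est; apply: cell_simplex_eq => k.
pose vert (u : _ -> nerve cell_groupoid 0) := sval (fob (u k) ord0).
exact: (congr1 vert est).
Qed.

Definition cell_cover : partial_groupoid := PartialGroupoid cell_nerve_spiny.

Definition in_cell (n : nat) (s : cell_cover n) (p : cell)
    (f : 'I_n.+1 -> 'I_(projT1 p).+1) : Prop :=
  forall k, sval (fob s k) = (p, star_edge (f k)).

(** The morphisms of [s] out of vertex 0 force all its vertices into one cell. *)
Lemma in_cell_ex (n : nat) (s : cell_cover n) :
  exists pf : {p : cell & 'I_n.+1 -> 'I_(projT1 p).+1}, in_cell s (projT2 pf).
Proof.
pose p := cell_of (fob s ord0).
have /choice [f fP] k : exists j : 'I_(projT1 p).+1,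
    sval (fob s k) = (p, star_edge j).
  have : p = cell_of (fob s k) := @fmor _ _ s ord0 k tt.
  rewrite /cell_of; case: (fob s k) => [[q e] [j /= ->]] /= pq.
  by case: q / pq j => j; exists j.
by exists (existT _ p f).
Qed.

Definition cell_map_fun (n : nat) (s : cell_cover n) : L n :=
  let: existT p f := sval (cid (in_cell_ex s)) in act f (projT2 p).

(** Independence of the choice: [s] determines the cell, and determines [f] up to equality of edges
    out of vertex 0, which is all the pullback sees. *)
Lemma cell_map_funE (n : nat) (s : cell_cover n) (p : cell)
    (f : 'I_n.+1 -> 'I_(projT1 p).+1) :
  in_cell s f -> cell_map_fun s = act f (projT2 p).
Proof.
rewrite /cell_map_fun; case: cid => -[q g] /= sg sf.
have eqp : q = p by have := sg ord0; rewrite sf => -[].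
subst q; apply: (act_eq_of_edge0 (@pg_spiny L)) => k.
by have := sg k; rewrite sf => /(congr1 snd).
Qed.

Lemma cell_map_act (m n : nat) (h : 'I_m.+1 -> 'I_n.+1) (s : cell_cover n) :
  cell_map_fun (act h s) = act h (cell_map_fun s).
Proof.
have [[p f] sf] := in_cell_ex s.
rewrite (cell_map_funE sf) -act_comp.
by rewrite (@cell_map_funE _ _ p (f \o h)) // => k; apply: sf.
Qed.

Definition cell_map : symmap cell_cover L := SymMap cell_map_act.

Lemma cell_map_characteristic : characteristic cell_map.
Proof.
split.
- apply/star_injectiveP => n s t.
  move/(congr1 (fun u : nerve cell_groupoid 0 => sval (fob u ord0))) => /=.
  have [[p f] sf] := in_cell_ex s; have [[q g] tg] := in_cell_ex t.
  rewrite (cell_map_funE sf) (cell_map_funE tg) /=.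
  rewrite (sf ord0) (tg ord0) => e0.
  (* A common initial vertex means the same cell and the same edge from its vertex 0; equal
     pullbacks then give equal edges to all other vertices. *)
  have epq : p = q := congr1 fst e0.
  subst q; move/(congr1 snd): e0 => /= e0 efg.
  apply: cell_simplex_eq => k; rewrite sf tg; congr pair.
  exact: (edge0_eq_of_act (@pg_spiny L) e0 efg).
- exists cell_groupoid, (@SymMap (nerve cell_groupoid) cell_cover
    (fun _ x => x) (fun _ _ _ _ => erefl)).
  by exists (@SymMap cell_cover (nerve cell_groupoid)
    (fun _ x => x) (fun _ _ _ _ => erefl)).
(* A preimage of [y] is the sequence of all vertices of the cell [y] itself, in order. *)
- move=> n y; pose p : cell := existT _ n y.
  pose o (k : 'I_n.+1) : cell_groupoid :=
    exist (fun q : cell * L 1 =>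
        exists k : 'I_(projT1 q.1).+1, q.2 = star_edge k)
      (p, @star_edge p k) (ex_intro _ k erefl).
  pose s : cell_cover n := @Functor (indiscrete 'I_n.+1) cell_groupoid o
    (fun _ _ _ => erefl) (fun _ => erefl) (fun _ _ _ _ _ => erefl).
  exists s; have -> : cell_map n s = act id y; last exact: act_id.
  exact: (@cell_map_funE n s p id).
Qed.

End Existence.

(** * Simplices of [BG] and of the transporter nerve in terms of group labels *)

Section Labels.
Variable G : groupType.
Local Open Scope group_scope.

Definition label (n : nat) (z : BG G n) (a b : 'I_n.+1) : G :=
  @fmor _ _ z a b tt.

Lemma label1 (n : nat) (z : BG G n) a : label z a a = 1.
Proof. exact: (fmor_id z a). Qed.

Lemma labelM (n : nat) (z : BG G n) a b c :
  label z a c = label z b c * label z a b.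
Proof. exact: (@fmor_comp _ _ z a b c tt tt). Qed.

Lemma labelV (n : nat) (z : BG G n) a b : label z b a = (label z a b)^-1.
Proof. by apply: (mulIg (label z a b)); rewrite mulVg -labelM label1. Qed.

(** The label of [a -> b] is that of [0 -> b] times the inverse of that of [0 -> a]. *)
Lemma label_cone_eq (n : nat) (y z : BG G n) :
  (forall a, label y ord0 a = label z ord0 a) -> y = z.
Proof.
move=> eyz0; have {eyz0} eyz a b : label y a b = label z a b.
  by rewrite (labelM y a ord0) (labelM z a ord0) !(labelV _ ord0 a) !eyz0.
case: y z eyz => [o m i c] [o' m' i' c'] /= eyz.
have eo : o = o' by apply/funext => k; apply: unit_eq.
by subst o'; apply: indiscrete_functor_eq.
Qed.

Lemma transporter_simplex_eq (S : Type) (p : partial_action G S) (n : nat)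
    (s t : nerve (transporter p) n) :
  (forall k, fob s k = fob t k) ->
  (forall a b, sval (@fmor _ _ s a b tt) = sval (@fmor _ _ t a b tt)) -> s = t.
Proof.
case: s t => [o m i c] [o' m' i' c'] /= /funext eo em.
subst o'; apply: indiscrete_functor_eq => a b; exact/tr_hom_eq/em.
Qed.

End Labels.

(** * The partial action on [E 0] and the comparison with its transporter groupoid *)

Section Action.
Variables (E L : partial_groupoid) (rho : symmap E L) (G : groupType).
Variable i : symmap L (BG G).
Hypotheses (rho_char : characteristic rho) (i_inj : sym_injective i).
Local Open Scope group_scope.

Definition elabel (n : nat) (e : E n) : 'I_n.+1 -> 'I_n.+1 -> G :=
  label (i n (rho n e)).

Lemma elabel_act (m n : nat) (f : 'I_m.+1 -> 'I_n.+1) (e : E n) a b :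
  elabel (act f e) a b = elabel e (f a) (f b).
Proof. by rewrite /elabel !symmap_act. Qed.

Lemma elabel_edge (n : nat) (e : E n) a b j k :
  elabel (edge e a b) j k = elabel e (eps a b j) (eps a b k).
Proof. exact: elabel_act. Qed.

(** The labels out of vertex 0 fix the simplex in [BG], hence in [L] as [i] is injective; star
    injectivity lifts this to [E]. *)
Lemma elabel_inj (n : nat) (s t : E n) : vertex s ord0 = vertex t ord0 ->
  (forall a, elabel s ord0 a = elabel t ord0 a) -> s = t.
Proof.
case: rho_char => /star_injectiveP rho_inj _ _ est elst.
by apply: rho_inj est _; apply: i_inj; apply: label_cone_eq.
Qed.

Definition moves (g : G) (x y : E 0) : Prop :=
  exists e : E 1%N, [/\ vertex e ord0 = x, vertex e ord_max = y &
    elabel e ord0 ord_max = g].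

Lemma moves_edge (n : nat) (e : E n) a b :
  moves (elabel e a b) (vertex e a) (vertex e b).
Proof. by exists (edge e a b); rewrite !vertex_edge elabel_edge. Qed.

Lemma moves_inj (g : G) (x y z : E 0) : moves g x y -> moves g x z -> y = z.
Proof.
move=> [e [ex <- eg]] [f [fx <- fg]]; congr vertex.
apply: elabel_inj => [|a]; first by rewrite ex fx.
case: (unliftP ord0 a) => [j ->|->]; last by rewrite /elabel !label1.
have -> : lift ord0 j = ord_max by apply: val_inj; rewrite ord1.
by rewrite eg fg.
Qed.

Lemma moves1 (x : E 0) : moves 1 x x.
Proof.
have := @moves_edge 0 x ord0 ord0.
by rewrite vertex0 /elabel label1.
Qed.

Lemma movesV (g : G) (x y : E 0) : moves g x y -> moves g^-1 y x.
Proof.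
move=> [e [<- <- <-]]; have := moves_edge e ord_max ord0.
by rewrite /elabel (labelV _ ord0).
Qed.

(* Any cone over x in E fills; the face opposite x is a simplex on the targets
   of the cone. *)
Lemma moves_cone (n : nat) (x : E 0) (y : 'I_n.+1 -> E 0) (g : 'I_n.+1 -> G) :
  (forall a, moves (g a) x (y a)) ->
  exists2 t : E n, vertex t = y &
    forall a b, elabel t a b = g b * (g a)^-1.
Proof.
move=> /choice [e eP]; case: rho_char => _ E_gpd _.
have [|t tP] := @groupoid_cone_ext E n x e E_gpd.
  by move=> a; case: (eP a).
have tg a : elabel t ord0 (lift ord0 a) = g a.
  by case: (eP a) => _ _ <-; rewrite -tP elabel_edge.
exists (act (lift ord0) t) => [|a b].
  apply/funext => a; rewrite vertex_act.
  by case: (eP a) => _ <- _; rewrite -tP vertex_edge.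
by rewrite elabel_act -!tg /elabel (labelM _ _ ord0) (labelV _ ord0).
Qed.

(** The cone is taken at the middle point [y], with legs [g^-1] to [x] and [h] to [z]; the opposite
    edge from [x] to [z] has label [h * (g^-1)^-1]. *)
Lemma movesM (g h : G) (x y z : E 0) :
  moves g x y -> moves h y z -> moves (h * g) x z.
Proof.
move=> /movesV gyx hyz.
pose T A (u v : A) (k : 'I_2) := if k == ord0 then u else v.
have [|t tv tg] := @moves_cone 1 y (T _ x z) (T _ g^-1 h).
  by move=> a; rewrite /T; case: ifP.
by have := moves_edge t ord0 ord_max; rewrite tv tg /T /= invgK.
Qed.

Definition edge_act_fun (g : G) (x : E 0) : option (E 0) :=
  if pselect (exists y, moves g x y) is left ex then Some (sval (cid ex))
  else None.

Lemma edge_act_funP (g : G) (x y : E 0) :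
  edge_act_fun g x = Some y <-> moves g x y.
Proof.
rewrite /edge_act_fun; case: pselect => [ex|nex]; last first.
  by split=> // gxy; case: nex; exists y.
case: cid => z /= gxz; split=> [[<-] //|gxy].
by congr Some; apply: moves_inj gxz gxy.
Qed.

Lemma edge_act1 x : edge_act_fun 1 x = Some x.
Proof. exact/edge_act_funP/moves1. Qed.

Lemma edge_actM g h x y z :
  edge_act_fun g x = Some y -> edge_act_fun h y = Some z ->
  edge_act_fun (h * g) x = Some z.
Proof.
move=> /edge_act_funP gxy /edge_act_funP hyz; apply/edge_act_funP.
exact: movesM gxy hyz.
Qed.

Lemma edge_actV g x y :
  edge_act_fun g x = Some y -> exists z, edge_act_fun g^-1 y = Some z.
Proof.
by move=> /edge_act_funP /movesV gyx; exists x; apply/edge_act_funP.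
Qed.

Definition edge_action : partial_action G (E 0) :=
  PartialAction edge_act1 edge_actM edge_actV.

Lemma edge_action_edge (n : nat) (e : E n) a b :
  edge_action (elabel e a b) (vertex e a) = Some (vertex e b).
Proof. exact/edge_act_funP/moves_edge. Qed.

Definition to_transporter_mor (n : nat) (e : E n) a b :
    tr_hom edge_action (vertex e a) (vertex e b) :=
  exist _ (elabel e a b) (edge_action_edge e a b).

Lemma to_transporter_id (n : nat) (e : E n) a :
  to_transporter_mor e a a = tr_id edge_action (vertex e a).
Proof. by apply: tr_hom_eq; apply: label1. Qed.

Lemma to_transporter_comp (n : nat) (e : E n) a b c :
  to_transporter_mor e a c =
  tr_comp (to_transporter_mor e a b) (to_transporter_mor e b c).
Proof. by apply: tr_hom_eq; apply: labelM. Qed.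

Definition to_transporter_fun (n : nat) (e : E n) :
    nerve (transporter edge_action) n :=
  @Functor (indiscrete 'I_n.+1) (transporter edge_action) (vertex e)
    (fun a b _ => to_transporter_mor e a b) (to_transporter_id e)
    (fun a b c _ _ => to_transporter_comp e a b c).

Lemma to_transporter_act (m n : nat) (f : 'I_m.+1 -> 'I_n.+1) (e : E n) :
  to_transporter_fun (act f e) = act f (to_transporter_fun e).
Proof.
apply: transporter_simplex_eq => [k|a b]; first exact: vertex_act.
exact: elabel_act.
Qed.

Definition to_transporter : symmap E (nerve (transporter edge_action)) :=
  SymMap to_transporter_act.

Lemma to_transporter_inj : sym_injective to_transporter.
Proof.
move=> n s t est; apply: elabel_inj => [|a].
  exact: (congr1 (fun u : nerve _ n => fob u ord0) est).
pose lab (u : nerve (transporter edge_action) n) : G :=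
  sval (@fmor _ _ u ord0 a tt).
exact: (congr1 lab est).
Qed.

(** The arrows of [s] out of vertex 0 come from edges of [E]; filling the cone they form gives the
    preimage. *)
Lemma to_transporter_surj : sym_surjective to_transporter.
Proof.
move=> n s; pose g a : G := sval (@fmor _ _ s ord0 a tt).
have gP a : moves (g a) (fob s ord0) (fob s a).
  exact/edge_act_funP/(svalP (@fmor _ _ s ord0 a tt)).
have [t tv tg] := moves_cone gP; exists t.
apply: transporter_simplex_eq => [k|a b]; first exact: (congr1 (@^~ k) tv).
(* After multiplication by [g a] this is functoriality of [s] along [0 -> a -> b]. *)
apply: etrans (tg a b) _; apply: (mulIg (g a)); rewrite -mulgA mulVg mulg1.
exact: (congr1 sval (@fmor_comp _ _ s ord0 a b tt tt)).
Qed.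

Lemma nerve_to_transporter (n : nat) (e : E n) :
  nerve_map (transporter_functor edge_action) n (to_transporter n e) =
  i n (rho n e).
Proof. by apply: label_cone_eq. Qed.

Lemma label_in_image (n : nat) (l : L n) :
  insub_sym (transporter_image edge_action) (i n l).
Proof.
case: rho_char => _ _ /(_ n l) [e <-].
by exists (to_transporter n e); apply: nerve_to_transporter.
Qed.

Definition to_transporter_image_fun (n : nat) (l : L n) :
    transporter_image edge_action n := exist _ (i n l) (label_in_image l).

Lemma to_transporter_image_act (m n : nat) (f : 'I_m.+1 -> 'I_n.+1) (l : L n) :
  to_transporter_image_fun (act f l) = act f (to_transporter_image_fun l).
Proof. by apply: subset_simplex_eq; rewrite /= symmap_act. Qed.

Definition to_transporter_image : symmap L (transporter_image edge_action) :=
  SymMap to_transporter_image_act.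

(** Injectivity is that of [i]. A simplex of the image lifts to the transporter nerve, then to [E],
    and its image under [rho] is the preimage in [L]. *)
Lemma to_transporter_image_iso : sym_iso to_transporter_image.
Proof.
apply: sym_iso_bij => [n l l' /(congr1 sval) /i_inj //|n [z [s sz]]].
have [e es] := to_transporter_surj s.
exists (rho n e); apply: subset_simplex_eq => /=.
by rewrite -sz -es nerve_to_transporter.
Qed.

End Action.

Theorem theorem1p2 (L : partial_groupoid) :
  (exists (E : partial_groupoid) (rho : symmap E L), characteristic rho) /\
  (forall (E : partial_groupoid) (rho : symmap E L) (G : groupType)
      (i : symmap L (BG G)),
    characteristic rho -> sym_injective i ->
    exists (a : partial_action G (E 0))
        (phi : symmap E (nerve (transporter a)))
        (psi : symmap L (transporter_image a)),
      (* psi is the identification L = L_{E_0}(G) of subobjects of BG *)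
      [/\ sym_iso phi,
          sym_iso psi,
          (forall (n : nat) (l : L n),
             subset_incl (transporter_image a) n (psi n l) = i n l) &
          (forall (n : nat) (e : E n),
             transporter_map a n (phi n e) = psi n (rho n e))]).
Proof.
split.
  by exists (cell_cover L), (cell_map L); apply: cell_map_characteristic.
move=> E rho G i rho_char i_inj.
exists (edge_action rho_char i_inj), (to_transporter rho_char i_inj),
  (to_transporter_image rho_char i_inj); split=> // [||n e].
- apply: sym_iso_bij; first exact: to_transporter_inj.
  exact: to_transporter_surj.
- exact: to_transporter_image_iso.
- by apply: subset_simplex_eq; apply: nerve_to_transporter.
Qed.
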